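(* Let $X$ be a finite set, let $t$ be a fixed positive integer, let $(\overline X,\overline{\mathcal B},\overline\rho)$, where $\overline X\subset X$, be a $t$-$(\overline s,k,\overline\lambda_t)$-divisible design, and let $G$ be a group acting on $X$. Suppose that the following properties hold: (a) For each $x\in X$ there is a unique element $\widehat x\in\overline X$ such that $x^G=\widehat x^G$. (b) All orbits $\overline x^G$, where $\overline x\in\overline X$, have the same cardinality. (c) Given any subset $Y=\{y_1,\dots,y_t\}$ of $X$ for which $\widehat Y:=\{\widehat y_1,\dots,\widehat y_t\}$ is a $\overline\rho$-transversal $t$-subset of $\overline X$, there exists at least one $g\in G$ with $Y^g=\widehat Y$. (d) All setwise stabilizers $G_{\overline Y}$, where $\overline Y\subset\overline X$ is any $\overline\rho$-transversal $t$-subset, have the same cardinality. (e) All setwise stabilizers $G_{\overline B}$, where $\overline B\in\overline{\mathcal B}$, have the same cardinality. Then $(X,\mathcal B,\rho)$ with $$\mathcal B:=\{\overline B^g\mid \overline B\in\overline{\mathcal B},\ g\in G\},\qquad \rho:=\{(x,x')\in X\times X\mid (\widehat x,\widehat x')\in\overline\rho\}$$ is a $t$-$(s,k,\lambda_t)$-divisible design, where $$s=(\#\overline x^G)\,\overline s,\qquad \lambda_t=\overline\lambda_t\,\frac{\#G_{\overline Y}}{\#G_{\overline B}}$$ for arbitrary $\overline x\in\overline X$, arbitrary $\overline\rho$-transversal $t$-subset $\overline Y\subset\overline X$ and arbitrary $\overline B\in\overline{\mathcal B}$.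
   Context: Let $X$ be a finite set with an equivalence relation $\rho$ (classes are called point classes). A subset $Y\subseteq X$ is $\rho$-transversal if it meets each point class in at most one element. A triple $(X,\mathcal B,\rho)$ is a $t$-$(s,k,\lambda_t)$-divisible design (with positive integers $t,s,k,\lambda_t$) if: (A) $\mathcal B$ is a set of $\rho$-transversal subsets of $X$ (blocks), each of size $k$; (B) each point class has size $s$; (C) each $\rho$-transversal $t$-subset of $X$ is contained in exactly $\lambda_t$ blocks; (D) $t\le v/s$ where $v=\#X$. Blocks are sets (no repeated blocks). $\#$ denotes cardinality; $x^G$ denotes the $G$-orbit of $x$ and $Z^g$ the image of a set $Z$ under $g$.
   Formalization: The group G is taken to be finite: for infinite G all the stabilizers are infinite, so the quotient #G_Y/#G_B defining λ_t is undefined, conditions (d) and (e) hold trivially, and the design property can fail. *)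

(* Defs.v *)
From HB Require Import structures.
From mathcomp Require Import all_boot all_order all_algebra all_fingroup.

Set Implicit Arguments.
Unset Strict Implicit.
Unset Printing Implicit Defensive.

(* A design lives on a subset X of a finite type T; only the restriction of
   the relation rho to X is ever used. *)

Definition point_classes (T : finType) (X : {set T}) (rho : rel T) :
    {set {set T}} :=
  equivalence_partition rho X.

Definition rho_transversal (T : finType) (X : {set T}) (rho : rel T)
    (Y : {set T}) : bool :=
  (Y \subset X) && [forall C in point_classes X rho, #|Y :&: C| <= 1].

Record divisible_design (T : finType) (t s k lambda : nat)
    (X : {set T}) (B : {set {set T}}) (rho : rel T) : Prop := DivisibleDesign {
  dd_t_gt0 : 0 < t;
  dd_s_gt0 : 0 < s;
  dd_k_gt0 : 0 < k;
  dd_lambda_gt0 : 0 < lambda;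
  dd_equiv : {in X & &, equivalence_rel rho};
  dd_block : forall b : {set T}, b \in B -> rho_transversal X rho b /\ #|b| = k;
  dd_class : forall C : {set T}, C \in point_classes X rho -> #|C| = s;
  dd_lambda : forall Y : {set T}, rho_transversal X rho Y -> #|Y| = t ->
    #|[set b in B | Y \subset b]| = lambda;
  (* By dd_class the Euclidean quotient is exact: it counts the classes. *)
  dd_t_le : t <= #|X| %/ s
}.

(* The default value x is irrelevant when x has a representative in Xbar. *)
Definition hat (X : finType) (gT : finGroupType) (to : {action gT &-> X})
    (G : {group gT}) (Xbar : {set X}) (x : X) : X :=
  odflt x [pick y in Xbar | orbit to G x == orbit to G y].

Definition lifted_blocks (X : finType) (gT : finGroupType)
    (to : {action gT &-> X}) (G : {group gT}) (Bbar : {set {set X}}) :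
    {set {set X}} :=
  [set to^*%act b g | b in Bbar, g in G].

Definition lifted_rel (X : finType) (gT : finGroupType)
    (to : {action gT &-> X}) (G : {group gT}) (Xbar : {set X})
    (rhobar : rel X) : rel X :=
  fun x x' => rhobar (hat to G Xbar x) (hat to G Xbar x').

(* Main.v *)
(* The map hat is constant on G-orbits and is the identity on Xbar, so an
   element of G that moves a point of Xbar into Xbar fixes that point.  Hence,
   for a t-subset Y of Xbar, a block b^g contains Y exactly when b contains Y
   and g fixes Y: the lifted blocks through Y are the disjoint union, over the
   blocks b of Bbar through Y, of the orbits of b under G_Y, each of size
   #G_Y / #G_b because G_b is a subgroup of G_Y.  A t-subset Y that is
   transversal for the lifted relation is moved onto hat Y by (c), and the set
   of lifted blocks is G-invariant, so Y lies on as many blocks as hat Y. *)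

Require Import Defs.
From HB Require Import structures.
From mathcomp Require Import all_boot all_order all_algebra all_fingroup.

Set Implicit Arguments.
Unset Strict Implicit.
Unset Printing Implicit Defensive.

(** * Transversal subsets of an equivalence relation *)

Section Transversal.

Variables (T : finType) (X : {set T}) (rho : rel T).
Hypothesis rho_equiv : {in X & &, equivalence_rel rho}.

Lemma rho_transversalP (Y : {set T}) :
  reflect (Y \subset X /\ {in Y &, forall x y, rho x y -> x = y})
          (rho_transversal X rho Y).
Proof.
apply: (iffP andP) => -[sYX].
  move/forall_inP=> trY; split=> // x y Yx Yy rxy.
  have [Xx Xy] := (subsetP sYX x Yx, subsetP sYX y Yy).
  have /trY/card_le1_eqP : [set z in X | rho x z] \in point_classes X rho.
    exact: imset_f.
  have [rxx _] := rho_equiv Xx Xx Xx.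
  by apply; rewrite !inE ?Yx ?Yy ?Xx ?Xy ?rxx.
move=> injY; split=> //; apply/forall_inP=> _ /imsetP[x Xx ->].
apply/card_le1_eqP=> y z; rewrite !inE => /and3P[Yy Xy rxy] /and3P[Yz Xz rxz].
apply: injY => //.
by have [_ /(_ rxz) <-] := rho_equiv Xx Xz Xy.
Qed.

Lemma rho_transversalS (Y Z : {set T}) :
  Z \subset Y -> rho_transversal X rho Y -> rho_transversal X rho Z.
Proof.
move=> sZY /rho_transversalP[sYX injY]; apply/rho_transversalP.
split=> [|x y Zx Zy]; first exact: subset_trans sYX.
by apply: injY; apply: (subsetP sZY).
Qed.

(** One point from each class gives a transversal set, and any [t] of its points still form one. In
    the main proof this supplies the [t]-subset from which the new constants are read off. *)
Lemma exists_rho_transversal (t : nat) :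
  t <= #|point_classes X rho| ->
  exists2 Y : {set T}, rho_transversal X rho Y & #|Y| = t.
Proof.
have partP := equivalence_partitionP rho_equiv.
have trP := transversalP partP.
set Z := transversal _ _ in trP.
rewrite -/(point_classes X rho) -(card_transversal trP) => le_tZ.
have trZ : rho_transversal X rho Z.
  have sZX := transversal_sub trP.
  apply/rho_transversalP; split=> // x y Zx Zy rxy.
  have [Xx Xy] := (subsetP sZX x Zx, subsetP sZX y Zy).
  apply: (pblock_inj trP Zx Zy); apply/esym/same_pblock.
    by case/and3P: partP.
  by rewrite pblock_equivalence_partition // rxy.
have : 0 < #|[set A : {set T} | A \subset Z & #|A| == t]|.
  by rewrite cards_draws bin_gt0.
rewrite card_gt0 => /set0Pn[Y]; rewrite inE => /andP[sYZ /eqP cardY].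
by exists Y => //; apply: rho_transversalS trZ.
Qed.

End Transversal.

(** * Orbit representatives and lifted blocks *)

Section OrbitRepresentatives.

Variables (X : finType) (Xbar : {set X}).
Variables (gT : finGroupType) (G : {group gT}) (to : {action gT &-> X}).
Hypothesis unique_rep : forall x : X, exists! xh : X,
  xh \in Xbar /\ orbit to G x = orbit to G xh.

Local Notation hat := (hat to G Xbar).

Lemma hatP (x : X) : hat x \in Xbar /\ orbit to G x = orbit to G (hat x).
Proof.
rewrite /Defs.hat; case: pickP => [y /andP[Xy /eqP] // | no_rep].
have [y [[Xy xy] _]] := unique_rep x.
by have := no_rep y; rewrite Xy xy eqxx.
Qed.

Lemma mem_hat (x : X) : hat x \in Xbar.
Proof. by have [] := hatP x. Qed.

(** Uniqueness in [unique_rep] enters here: if [x] lies in the orbit of [y], then [hat x] and [y]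
    represent the same orbit. *)
Lemma hat_eq (x y : X) :
  y \in Xbar -> (hat x == y) = (x \in orbit to G y).
Proof.
move=> Xy; have [Xh xh] := hatP x.
apply/eqP/orbit_eqP=> [<- // | xy].
have [z [_ uz]] := unique_rep x.
by rewrite -(uz _ (conj Xh xh)) -(uz _ (conj Xy xy)).
Qed.

Lemma hat_id : {in Xbar, forall x, hat x = x}.
Proof. by move=> x Xx; apply/eqP; rewrite hat_eq // orbit_refl. Qed.

Lemma hat_act (x : X) (g : gT) : g \in G -> hat (to x g) = hat x.
Proof.
move=> Gg; have [Xh xh] := hatP x; apply/eqP; rewrite hat_eq // -xh.
exact: mem_orbit.
Qed.

Lemma imset_hat_setact (A : {set X}) (g : gT) :
  A \subset Xbar -> g \in G -> hat @: (to^*%act A g) = A.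
Proof.
move=> sAX Gg; rewrite /= setactE -imset_comp -[RHS]imset_id.
apply: eq_in_imset => x Ax /=.
by rewrite hat_act // hat_id // (subsetP sAX).
Qed.

Lemma act_fix_rep (x : X) (g : gT) :
  x \in Xbar -> g \in G -> to x g \in Xbar -> to x g = x.
Proof. by move=> Xx Gg Xxg; rewrite -(hat_id Xxg) hat_act // hat_id. Qed.

(** The fibre of [hat] over a point of [Xbar] is the orbit of that point. Applied to a point class
    and to [Xbar], this gives the new class size and the size of [X]. *)
Lemma card_preimset_hat (n : nat) (A : {set X}) :
  A \subset Xbar -> {in A, forall x, #|orbit to G x| = n} ->
  #|hat @^-1: A| = n * #|A|.
Proof.
move=> sAX orbA; rewrite -sum1_card (partition_big hat (mem A)) /=; last first.
  by move=> x; rewrite inE.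
rewrite mulnC -sum_nat_const; apply: eq_bigr => y Ay.
rewrite -(orbA y Ay) -sum1_card; apply: eq_bigl => x.
rewrite inE -hat_eq ?(subsetP sAX) //.
by case: eqP => [-> | _]; rewrite ?andbF // andbT Ay.
Qed.

(** An element stabilizing [A] moves points of [A] within [Xbar], so it fixes [A] pointwise, and
    hence every subset of [A]. *)
Lemma astabs_repS (Y A : {set X}) :
  A \subset Xbar -> Y \subset A -> 'N_G(A | to)%g \subset 'N_G(Y | to)%g.
Proof.
move=> sAX sYA; apply/subsetP=> g /setIP[Gg NAg].
rewrite !inE Gg /=; apply/subsetP=> y Yy; rewrite inE.
have Ay := subsetP sYA y Yy.
rewrite act_fix_rep // (subsetP sAX) // ?(astabs_act _ NAg) //.
Qed.

(** Taking the image under [hat] recovers from a lifted block its origin in [Bbar]; this identifies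
    the fibre over [b] among the lifted blocks through [Y]. *)
Lemma lifted_block_over (Bbar : {set {set X}}) (Y b c : {set X}) :
    {in Bbar, forall A : {set X}, A \subset Xbar} -> b \in Bbar ->
    Y \subset b ->
  [&& c \in lifted_blocks to G Bbar, Y \subset c & hat @: c == b]
    = (c \in orbit to^*%act 'N_G(Y | to)%g b).
Proof.
move=> sBX Bb sYb; apply/and3P/orbitP.
  case=> /imset2P[b' g Bb' Gg ->] sYc.
  rewrite imset_hat_setact ?sBX // => /eqP def_b; rewrite def_b in sYc *.
  exists g => //; rewrite !inE Gg /=; apply/subsetP=> y Yy; rewrite inE.
  have Xy := subsetP (sBX b Bb) y (subsetP sYb y Yy).
  (* Here [y] is the image under [g] of some [x] in [b]; both are representatives of one orbit, so
     [x = y] and [g] fixes [y]. *)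
  have /imsetP[x bx def_y] := subsetP sYc y Yy.
  have Xx := subsetP (sBX b Bb) x bx.
  have xy : x = y by rewrite -(hat_id Xx) -(hat_act x Gg) -def_y hat_id.
  by rewrite -{1}xy -def_y.
case=> g /setIP[Gg NYg] <-; split.
- exact: imset2_f.
- by rewrite -(astabs_setact NYg); apply: imsetS.
- by rewrite imset_hat_setact ?sBX.
Qed.

Lemma card_lifted_blocks_over (Bbar : {set {set X}}) (m : nat) (Y : {set X}) :
    {in Bbar, forall b : {set X}, b \subset Xbar} ->
    {in Bbar, forall b : {set X}, #|'N_G(b | to)%g| = m} -> Y \subset Xbar ->
  #|[set c in lifted_blocks to G Bbar | Y \subset c]| * m
    = #|[set b in Bbar | Y \subset b]| * #|'N_G(Y | to)%g|.
Proof.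
move=> sBX stabB sYX.
rewrite -sum1dep_card.
rewrite (partition_big (fun c : {set X} => hat @: c)
           (mem [set b in Bbar | Y \subset b])) /=; last first.
  move=> _ /andP[/imset2P[b g Bb Gg ->] sYc].
  rewrite inE imset_hat_setact ?sBX // Bb /=.
  (* Both sides become images under [hat], with [Y] first moved by the identity, so that [sYc]
     suffices. *)
  rewrite -(imset_hat_setact (sBX b Bb) Gg) -[Y](imset_hat_setact _ (group1 G)) //.
  by rewrite /= (act1 to^*%act); apply: imsetS.
rewrite big_distrl /= -sum_nat_const; apply: eq_bigr => b.
rewrite inE => /andP[Bb sYb].
rewrite -(card_orbit_stab to^*%act 'N_G(Y | to)%G b) astab1_set.
(* The orbit-stabilizer formula is used inside the stabilizer of [Y], which already contains that of
   [b]. *)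
have -> : 'N_('N_G(Y | to))(b | to)%g = 'N_G(b | to)%g.
  apply/eqP; rewrite eqEsubset setSI ?subsetIl //=.
  by rewrite subsetI astabs_repS ?sBX // subsetIr.
rewrite stabB // -[#|orbit _ _ _|]sum1_card; congr (_ * _).
by apply: eq_bigl => c; rewrite -andbA lifted_block_over.
Qed.

Lemma setact_lifted_blocks (Bbar : {set {set X}}) (c : {set X}) (g : gT) :
  g \in G ->
  (to^*%act c g \in lifted_blocks to G Bbar)
    = (c \in lifted_blocks to G Bbar).
Proof.
have lift_act h d : h \in G -> d \in lifted_blocks to G Bbar ->
    to^*%act d h \in lifted_blocks to G Bbar.
  move=> Gh /imset2P[b k Bb Gk ->]; rewrite -(actM to^*%act).
  by rewrite imset2_f ?groupM.
move=> Gg; apply/idP/idP=> [/(lift_act g^-1%g) | /lift_act-> //].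
by rewrite groupV (actK to^*%act); apply.
Qed.

Lemma card_lifted_blocks_setact (Bbar : {set {set X}}) (Y : {set X}) (g : gT) :
  g \in G ->
  #|[set c in lifted_blocks to G Bbar | to^*%act Y g \subset c]|
    = #|[set c in lifted_blocks to G Bbar | Y \subset c]|.
Proof.
move=> Gg; rewrite -[RHS](card_imset _ (act_inj to^*%act g)); apply: eq_card => c.
rewrite inE; apply/andP/imsetP=> [[Lc sYc] | [d]].
  exists (to^*%act c g^-1%g); last by rewrite (actKV to^*%act).
  rewrite inE setact_lifted_blocks ?groupV // Lc /=.
  by rewrite -[Y](actK to^*%act g); apply: imsetS.
rewrite inE => /andP[Ld sYd] ->; rewrite setact_lifted_blocks //.
by split=> //; apply: imsetS.
Qed.

End OrbitRepresentatives.

(** * The lifted design and its parameters *)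

Theorem theorem2p5 (X : finType) (t : nat) (t_gt0 : 0 < t)
    (Xbar : {set X}) (Bbar : {set {set X}}) (rhobar : rel X)
    (sbar k lambdabar : nat)
    (design_bar : divisible_design t sbar k lambdabar Xbar Bbar rhobar)
    (gT : finGroupType) (G : {group gT}) (to : {action gT &-> X})
    (hyp_a : forall x : X, exists! xh : X,
       xh \in Xbar /\ orbit to G x = orbit to G xh)
    (hyp_b : forall x y : X, x \in Xbar -> y \in Xbar ->
       #|orbit to G x| = #|orbit to G y|)
    (hyp_c : forall Y : {set X}, #|Y| = t ->
       rho_transversal Xbar rhobar (hat to G Xbar @: Y) ->
       #|hat to G Xbar @: Y| = t ->
       exists2 g : gT, g \in G & (to^*)%act Y g = hat to G Xbar @: Y)
    (hyp_d : forall Y Z : {set X},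
       rho_transversal Xbar rhobar Y -> #|Y| = t ->
       rho_transversal Xbar rhobar Z -> #|Z| = t ->
       #|'N_G(Y | to)%g| = #|'N_G(Z | to)%g|)
    (hyp_e : forall b c : {set X}, b \in Bbar -> c \in Bbar ->
       #|'N_G(b | to)%g| = #|'N_G(c | to)%g|) :
  exists s lambda : nat,
    [/\ divisible_design t s k lambda [set: X]
          (lifted_blocks to G Bbar) (lifted_rel to G Xbar rhobar),
        forall x : X, x \in Xbar -> s = #|orbit to G x| * sbar
      & forall Y b : {set X},
          rho_transversal Xbar rhobar Y -> #|Y| = t -> b \in Bbar ->
          (lambda%:R = lambdabar%:R *
            (#|'N_G(Y | to)%g|%:R / #|'N_G(b | to)%g|%:R) :> rat)%R].
Proof.
case: design_bar => _ sbar_gt0 k_gt0 lambdabar_gt0 eqv_bar block_bar class_bar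
  lambda_bar t_le_bar.
have trP := rho_transversalP eqv_bar.
have sBX : {in Bbar, forall b : {set X}, b \subset Xbar}.
  by move=> b /block_bar[/trP[]].
have part_bar := equivalence_partitionP eqv_bar.
have cardXbar : #|Xbar| = #|point_classes Xbar rhobar| * sbar.
  by apply: card_uniform_partition part_bar => C; apply: class_bar.
have [|Y0 trY0 cardY0] := @exists_rho_transversal _ _ _ eqv_bar t.
  by rewrite cardXbar mulnK in t_le_bar.
have [sY0X _] := trP _ trY0.
(* Since [lambdabar] is positive, some block passes through [Y0]; its stabilizer provides the common
   order [m]. *)
have /card_gt0P[b0] : 0 < #|[set b in Bbar | Y0 \subset b]|.
  by rewrite lambda_bar.
rewrite inE => /andP[Bb0 _].
have /card_gt0P[x0 Y0x0] : 0 < #|Y0| by rewrite cardY0.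
have Xx0 := subsetP sY0X _ Y0x0.
pose n := #|orbit to G x0|.
have n_gt0 : 0 < n by apply/card_gt0P; exists x0; apply: orbit_refl.
have orbX : {in Xbar, forall x, #|orbit to G x| = n}.
  by move=> x Xx; apply: hyp_b.
pose m := #|'N_G(b0 | to)%g|.
have stabB : {in Bbar, forall b : {set X}, #|'N_G(b | to)%g| = m}.
  by move=> b Bb; apply: hyp_e.
have m_gt0 : 0 < m by apply: cardG_gt0.
pose deg (Y : {set X}) :=
  #|[set c in lifted_blocks to G Bbar | Y \subset c]|.
(* By (d) the right-hand side does not depend on [Y], so cancelling [m] will make [deg] constant. *)
have degE Y : rho_transversal Xbar rhobar Y -> #|Y| = t ->
    deg Y * m = lambdabar * #|'N_G(Y0 | to)%g|.
  move=> trY cardY; have [sYX _] := trP _ trY.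
  rewrite /deg (card_lifted_blocks_over hyp_a sBX stabB sYX).
  by rewrite lambda_bar // (hyp_d Y Y0).
have deg_const Y : rho_transversal Xbar rhobar Y -> #|Y| = t -> deg Y = deg Y0.
  by move=> trY cardY; apply/eqP; rewrite -(eqn_pmul2r m_gt0) !degE.
have eqv : {in [set: X] & &, equivalence_rel (lifted_rel to G Xbar rhobar)}.
  by move=> x y z _ _ _; apply: eqv_bar; apply: mem_hat.
have trX := rho_transversalP eqv.
exists (n * sbar), (deg Y0); split.
- split=> //.
  + by rewrite muln_gt0 n_gt0.
  + by rewrite -(ltn_pmul2r m_gt0) mul0n degE // muln_gt0 lambdabar_gt0 cardG_gt0.
  + move=> _ /imset2P[b g Bb Gg ->]; have [/trP[sbX inj_b] cardb] := block_bar b Bb.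
    split; last by rewrite card_setact.
    apply/trX; split=> [|_ _ /imsetP[x bx ->] /imsetP[y by_ ->]].
      exact: subsetT.
    have [Xx Xy] := (subsetP sbX x bx, subsetP sbX y by_).
    by rewrite /lifted_rel !hat_act // !hat_id // => /inj_b->.
  + move=> _ /imsetP[x _ ->].
    (* The lifted class of [x] is the preimage under [hat] of the class [C] of [hat x]. *)
    pose C := [set y in Xbar | rhobar (hat to G Xbar x) y].
    have sCX : C \subset Xbar by apply/subsetP=> y; rewrite inE => /andP[].
    have <- : #|C| = sbar.
      by apply: class_bar; apply: imset_f; apply: mem_hat.
    have orbC : {in C, forall y, #|orbit to G y| = n}.
      by move=> y Cy; rewrite orbX // (subsetP sCX).
    rewrite -(card_preimset_hat hyp_a sCX orbC); apply: eq_card => y.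
    by rewrite !inE mem_hat.
  + move=> Y /trX[_ injY] cardY.
    (* Points with equal [hat] are related, by reflexivity of [rhobar] on [Xbar], so transversality
       of [Y] makes them equal. *)
    have injhat : {in Y &, injective (hat to G Xbar)}.
      move=> x y Yx Yy xy; apply: injY => //; rewrite /lifted_rel xy.
      by have [] := eqv_bar _ _ _ (mem_hat hyp_a y) (mem_hat hyp_a y)
                      (mem_hat hyp_a y).
    have cardhY : #|hat to G Xbar @: Y| = t by rewrite card_in_imset.
    have trhY : rho_transversal Xbar rhobar (hat to G Xbar @: Y).
      apply/trP; split.
        by apply/subsetP=> _ /imsetP[x _ ->]; apply: mem_hat.
      by move=> _ _ /imsetP[x Yx ->] /imsetP[y Yy ->] /injY->.
    have [g Gg defhY] := hyp_c Y cardY trhY cardhY.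
    by rewrite -(deg_const _ trhY cardhY) -defhY /deg card_lifted_blocks_setact.
  (* The point count and the class size both gain the factor [n], so their quotient is unchanged. *)
  + have -> : #|[set: X]| = n * #|Xbar|.
      rewrite -(card_preimset_hat hyp_a (subxx Xbar) orbX); apply: eq_card => x.
      by rewrite !inE mem_hat.
    by rewrite divnMl.
- by move=> x Xx; rewrite orbX.
- move=> Y b trY cardY Bb.
  rewrite -(deg_const Y) // (stabB b) //.
  (* Clearing the denominator [m] turns the rational identity into [degE]. *)
  have m_neq0 : (m%:R != 0 :> rat)%R by rewrite Num.Theory.pnatr_eq0 -lt0n.
  apply: (GRing.mulIf m_neq0).
  rewrite -GRing.mulrA GRing.divfK // -!GRing.natrM degE //.
  by rewrite (hyp_d Y Y0).
Qed.
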